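(* Let $K=\mathbb{F}_q$ be a finite field with $q$ elements. Let $\mathcal{G}$ be a bipartite (simple, finite) graph with a perfect matching, with $n=2k$ vertices and $m$ connected components, and let $\mathbb{X}$ be the toric set over $K$ parameterized by the edges of $\mathcal{G}$. Let $S=K[X_1,\ldots,X_s]$, where $s$ is the number of edges of $\mathcal{G}$, let $I_{\mathbb{X}}\subseteq S$ be the vanishing ideal of $\mathbb{X}$, and for an integer $d\ge 0$ let $C_{\mathbb{X}}(d)$ be the code of order $d$ parameterized by the edges of $\mathcal{G}$, with minimum distance $\delta_{\mathbb{X}}(d)$. Then: (1) The length of the code $C_{\mathbb{X}}(d)$ is $$|\mathbb{X}|=(q-1)^{n-m-1}.$$ (2) The regularity index of $S/I_{\mathbb{X}}$ satisfies $$\left\lceil \frac{(q-2)(n-1)}{2(q-1)^{m}}\right\rceil \leq \mathrm{reg}(S/I_{\mathbb{X}}) \leq (q-2)(k-1)+(q-1)^{k-m}-1.$$ (3) The dimension of the code $C_{\mathbb{X}}(d)$ satisfies $$\dim_K C_{\mathbb{X}}(d) \geq \sum_{j=0}^{\lfloor d/(q-1)\rfloor} (-1)^j \binom{k-1}{j}\binom{k-1+d-j(q-1)}{k-1}.$$ (4) The minimum distance of the code $C_{\mathbb{X}}(d)$ satisfies $$\left\lceil \frac{\delta_{\mathbb{T}_{n-1}}(2d)}{(q-1)^m}\right\rceil \leq \delta_{\mathbb{X}}(d) \leq (q-1)^{k-m}\,\delta_{\mathbb{T}_{k-1}}(d).$$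
   Context: Let $K=\mathbb{F}_q$ and $K^*=K\setminus\{0\}$. The projective torus of dimension $r-1$ is $\mathbb{T}_{r-1}=\{[t_1,\ldots,t_r]\in\mathbb{P}^{r-1}: t_i\in K^*\text{ for all } i\}$, where $\mathbb{P}^{r-1}$ is the projective space over $K$. For a simple graph $\mathcal{G}$ with vertices $v_1,\ldots,v_n$ and edges $e_1,\ldots,e_s$, and $(t_1,\ldots,t_n)\in(K^* )^n$, put $(t_1,\ldots,t_n)^{e_i}=t_jt_l$ when $e_i=\{v_j,v_l\}$. The toric set parameterized by the edges of $\mathcal{G}$ is $$\mathbb{X}=\{[(t_1,\ldots,t_n)^{e_1},\ldots,(t_1,\ldots,t_n)^{e_s}]\in\mathbb{P}^{s-1}: t_i\in K^*\}.$$ For a nonempty set of points $\mathbb{Z}=\{P_1,\ldots,P_N\}\subseteq\mathbb{T}_{r-1}$ with $N=|\mathbb{Z}|$, and the polynomial ring $A=K[X_1,\ldots,X_r]=\oplus_{d\ge0}A_d$ with the standard grading, the code of order $d$ associated with $\mathbb{Z}$ is the subspace $$C_{\mathbb{Z}}(d)=\left\{\left(\frac{f(P_1)}{X_1^d(P_1)},\ldots,\frac{f(P_N)}{X_1^d(P_N)}\right): f\in A_d\right\}\subseteq K^{N}.$$ Its length is $N$. Its minimum distance $\delta_{\mathbb{Z}}(d)$ is the minimum Hamming weight (number of nonzero entries) of a nonzero vector of $C_{\mathbb{Z}}(d)$. The vanishing ideal $I_{\mathbb{Z}}\subseteq A$ is the ideal generated by the homogeneous polynomials vanishing at all points of $\mathbb{Z}$;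 $I_{\mathbb{Z}}(d)=I_{\mathbb{Z}}\cap A_d$; the Hilbert function is $H_{\mathbb{Z}}(d)=\dim_K(A_d/I_{\mathbb{Z}}(d))=\dim_K C_{\mathbb{Z}}(d)$. The regularity index $\mathrm{reg}(A/I_{\mathbb{Z}})$ is the least integer $d\ge 0$ such that $H_{\mathbb{Z}}(d)=|\mathbb{Z}|$.
   Formalization: The lower bound in (2) is asserted only for k ≥ 2 or q = 2: for k = 1 and q ≥ 3 the graph is a single edge, X is one point and reg(S/I_X) = 0, while the printed lower bound equals 1. *)

(* Defs.v *)
From HB Require Import structures.
From mathcomp Require Import all_boot all_order all_algebra fingroup.
From mathcomp.multinomials Require Import mpoly.

Set Implicit Arguments.
Unset Strict Implicit.
Unset Printing Implicit Defensive.

Import Order.TTheory GRing.Theory Num.Theory.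

(* Vertices are 'I_n and edges carry labels in 'I_s; injectivity of the
   labelling rules out parallel edges, cardinality 2 rules out loops. *)
Record sgraph (n s : nat) := SGraph {
  edge :> 'I_s -> {set 'I_n};
  edge_card : forall i, #|edge i| = 2;
  edge_inj : injective edge }.

Section Graphs.

Variables (n s : nat) (G : sgraph n s).

Definition edge_set : {set {set 'I_n}} := [set G i | i : 'I_s].

Definition adj : rel 'I_n := fun x y => [set x; y] \in edge_set.

Definition bipartite : Prop :=
  exists A : {set 'I_n}, forall x y, adj x y -> (x \in A) != (y \in A).

Definition has_perfect_matching : Prop :=
  exists2 M : {set {set 'I_n}}, M \subset edge_set & partition M [set: 'I_n].

Definition components : nat := n_comp adj 'I_n.

End Graphs.

Local Open Scope ring_scope.

Section Codes.

Variables (K : finFieldType) (r : nat).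

(* A point of the projective space P^r over K is the class of a nonzero vector
   of K^(r+1) modulo K^*, represented as the set of its representatives. *)
Definition ppoint (x : 'rV[K]_r.+1) : {set 'rV[K]_r.+1} :=
  [set a *: x | a in [set a : K | a != 0]].

Definition torus : {set {set 'rV[K]_r.+1}} :=
  [set ppoint t | t : 'rV[K]_r.+1 & [forall i, t 0 i != 0]].

Variable Z : {set {set 'rV[K]_r.+1}}.

Definition prepr (P : {set 'rV[K]_r.+1}) : 'rV[K]_r.+1 :=
  odflt 0 [pick x in P].

(* For f homogeneous of degree d, f(x) / x_1^d is the same for all
   representatives x of a point of the torus; the variable X_1 is ord0. *)
Definition codeword (d : nat) (f : dhomog r.+1 K d) : 'rV[K]_#|Z| :=
  \row_j let x := prepr (enum_val j) in
         (val f).@[x 0] / ('X_ord0 ^+ d : {mpoly K[r.+1]}).@[x 0].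

Fact codeword_is_linear d : linear (@codeword d).
Proof.
move=> a f g; apply/rowP => j; rewrite !mxE /= mevalD mevalZ.
by rewrite mulrDl mulrA.
Qed.

HB.instance Definition _ d :=
  GRing.isLinear.Build K (dhomog r.+1 K d) 'rV[K]_#|Z| _ (@codeword d)
    (@codeword_is_linear d).

Definition code (d : nat) : {vspace 'rV[K]_#|Z|} := limg (linfun (@codeword d)).

Lemma mem_code d (c : 'rV[K]_#|Z|) :
  reflect (exists f : dhomog r.+1 K d, c = codeword f) (c \in code d).
Proof.
apply: (iffP memv_imgP) => [[f _ ->]|[f ->]].
  by exists f; rewrite lfunE.
by exists f; rewrite ?memvf ?lfunE.
Qed.

Definition hamming_weight (N : nat) (c : 'rV[K]_N) : nat :=
  #|[set j | c 0 j != 0]|.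

(* No weight exceeds #|Z|, so the default value of the minimum is harmless as
   long as the code is nonzero. *)
Definition min_distance (d : nat) : nat :=
  \big[minn/#|Z|]_(c : 'rV[K]_#|Z| | (c \in code d) && (c != 0))
     hamming_weight c.

Definition homog_vanishing (h : {mpoly K[r.+1]}) : Prop :=
  (exists d : nat, h \is d.-homog) /\ (forall P x, P \in Z -> x \in P -> h.@[x 0] = 0).

Definition vanishing_ideal (f : {mpoly K[r.+1]}) : Prop :=
  exists2 gh : seq ({mpoly K[r.+1]} * {mpoly K[r.+1]}),
    (forall p, p \in gh -> homog_vanishing p.2) &
    f = \sum_(p <- gh) p.1 * p.2.

(* The dimension of A_d / I_Z(d) is h, W being I_Z(d) as a subspace of A_d. *)
Definition hilbert_value (d h : nat) : Prop :=
  exists2 W : {vspace dhomog r.+1 K d},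
    (forall f, f \in W <-> vanishing_ideal (val f)) &
    h = (\dim {: dhomog r.+1 K d} - \dim W)%N.

Definition regularity_index (e : nat) : Prop :=
  hilbert_value e #|Z| /\ (forall d, hilbert_value d #|Z| -> (e <= d)%N).

End Codes.

(* A graph with s.+1 edges parameterizes a subset of P^s. *)
Definition toric_set (K : finFieldType) (n s : nat) (G : sgraph n s.+1) :
    {set {set 'rV[K]_s.+1}} :=
  [set ppoint (\row_i \prod_(j in G i) t j)
    | t : {ffun 'I_n -> K} & [forall j, t j != 0]].

(* Main.v *)
(* Monomial maps between tori are group morphisms, so all their fibres have
   the same size, and weights and cardinalities in a projective toric set can
   be counted upstairs in the affine torus T of K^n. For the edge map of a
   bipartite graph with m components the common size is (q-1)^(m+1): the
   points of T with scalar image are given by that scalar and one free value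
   per component. Edge monomials pull X back to the torus T_(n-1) in degree
   2d, and the k edges of a perfect matching project X onto T_(k-1), with
   fibres of (q-1)^(k-m) points; this gives (1) and (4). The characters of the
   affine torus of K^(k-1) with exponents at most q-2 and total degree at most
   d give independent codewords, whose number is the alternating sum of (3).
   For the upper bound of (2), a point of X is separated from the others by
   the indicator of its projection in T_(k-1), of degree (q-2)(k-1), times a
   product of linear forms, one for each other point of its fibre. For the
   lower bound, the indicator of [1:...:1] pulls back to a polynomial of
   degree 2d in the vertex variables; setting m+1 of them to 1 makes it the
   indicator of a single point among the remaining n-m-1, which requires
   degree at least (q-2)(n-m-1). *)

Require Import Defs.
From mathcomp Require Import all_boot all_order all_algebra.
From mathcomp Require Import finfield.
From mathcomp.multinomials Require Import mpoly.
From mathcomp Require Import zify ring.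

Set Implicit Arguments.
Unset Strict Implicit.
Unset Printing Implicit Defensive.

Import Order.TTheory GRing.Theory Num.Theory.
Local Open Scope ring_scope.

(** * Points and monomial maps *)

Section ProjectivePoints.

Variables (K : finFieldType) (r : nat).
Implicit Types x y : 'rV[K]_r.+1.

Lemma ppointP x y : reflect (exists2 a, a != 0 & x = a *: y) (x \in ppoint y).
Proof.
apply: (iffP imsetP) => [[a]|[a a0 ->]]; first by rewrite inE; exists a.
by exists a; rewrite ?inE.
Qed.

Lemma ppoint_id x : x \in ppoint x.
Proof. by apply/ppointP; exists 1; rewrite ?oner_eq0 ?scale1r. Qed.

Lemma ppointZ a x : a != 0 -> ppoint (a *: x) = ppoint x.
Proof.
move=> a0; apply/setP => y; apply/ppointP/ppointP => -[b b0 ->].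
  by exists (b * a); rewrite ?mulf_neq0 // scalerA.
by exists (b / a); rewrite ?mulf_neq0 ?invr_eq0 // scalerA divfK.
Qed.

Lemma eq_ppoint x y : x 0 0 != 0 -> y 0 0 != 0 ->
  (ppoint x == ppoint y) = [forall i, x 0 i * y 0 0 == y 0 i * x 0 0].
Proof.
move=> x0 y0; apply/eqP/forallP => [exy i|xy].
  have /ppointP[a _ ->] : x \in ppoint y by rewrite -exy ppoint_id.
  by rewrite !mxE mulrCA mulrA.
have -> : x = (x 0 0 / y 0 0) *: y.
  apply/rowP => i; rewrite !mxE mulrAC; apply: (canRL (mulfK y0)).
  by rewrite (eqP (xy i)) mulrC.
by rewrite ppointZ // mulf_neq0 ?invr_eq0.
Qed.

Lemma prepr_ppoint y : exists2 a, a != 0 & prepr (ppoint y) = a *: y.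
Proof.
rewrite /prepr; case: pickP => [x /ppointP //|/(_ y)].
by rewrite ppoint_id.
Qed.

Lemma meval_dhomog n d (f : {mpoly K[n]}) a (v : 'I_n -> K) :
  f \is d.-homog -> f.@[fun i => a * v i] = a ^+ d * f.@[v].
Proof.
move=> /dhomogP fd; rewrite !mevalE mulr_sumr big_seq [RHS]big_seq.
apply: eq_bigr => m /fd /= <-; rewrite mulrCA; congr (_ * _).
rewrite mdegE -prodrXr -big_split /=.
by apply: eq_bigr => i _; rewrite exprMn.
Qed.

(** Replacing [y] by [a *: y] multiplies numerator and denominator by the same [a ^+ d], so the
    representative chosen by [prepr] does not matter. *)
Lemma codewordE (Z : {set {set 'rV[K]_r.+1}}) d (f : dhomog r.+1 K d) j y :
  enum_val j = ppoint y ->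
  codeword Z f 0 j = (val f).@[y 0] / y 0 0 ^+ d.
Proof.
move=> jy; rewrite mxE jy; have [a a0 ->] := prepr_ppoint y.
cbv zeta; rewrite rmorphXn /= mevalXU mxE.
rewrite (meval_eq (v2 := fun i => a * y 0 i)); last by move=> i; rewrite mxE.
rewrite (meval_dhomog _ _ (dhomog_is_dhomog f)) exprMn invfM mulrACA.
by rewrite divff ?mul1r ?expf_neq0.
Qed.

End ProjectivePoints.

(** * Monomial maps from affine tori: kernels, fibres and weights *)

Section MonomialMaps.

Variable K : finFieldType.
Implicit Types N r : nat.

Lemma card_nonzero : #|[pred x : K | x != 0]| = #|K|.-1.
Proof. by rewrite [in RHS](cardD1 0 K) inE; apply: eq_card => x; rewrite !inE andbT. Qed.

Definition atorus N : {set {ffun 'I_N -> K}} :=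
  [set t : {ffun 'I_N -> K} | [forall j, t j != 0]].

Lemma atorusP N (t : {ffun 'I_N -> K}) :
  reflect (forall j, t j != 0) (t \in atorus N).
Proof. by rewrite inE; apply: forallP. Qed.

Lemma card_atorus N : #|atorus N| = (#|K|.-1 ^ N)%N.
Proof.
have -> : #|atorus N| = #|ffun_on [pred x : K | x != 0] : {pred {ffun 'I_N -> K}}|.
  by apply: eq_card => t; apply/atorusP/ffun_onP.
by rewrite card_ffun_on card_ord card_nonzero.
Qed.

Definition monomap N r (E : 'I_r.+1 -> {set 'I_N}) (t : {ffun 'I_N -> K}) :
  'rV[K]_r.+1 := \row_i \prod_(j in E i) t j.

(** The family [E] is arbitrary, so that one theory covers the projective torus (singletons), the
    toric set of a graph (its edges) and its projection (the edges of a matching). *)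
Definition mset N r (E : 'I_r.+1 -> {set 'I_N}) : {set {set 'rV[K]_r.+1}} :=
  [set ppoint (\row_i \prod_(j in E i) t j)
    | t : {ffun 'I_N -> K} & [forall j, t j != 0]].

Lemma msetP N r (E : 'I_r.+1 -> {set 'I_N}) P :
  reflect (exists2 t, t \in atorus N & P = ppoint (monomap E t)) (P \in mset E).
Proof.
by apply: (iffP imsetP) => -[t tN ->]; exists t; rewrite // inE in tN *.
Qed.

Lemma torus_mset r : torus K r = mset (fun i => [set i]).
Proof.
apply/setP => P; apply/imsetP/msetP => [[x]|[t /atorusP t0 ->]].
  rewrite inE => /forallP x0 ->; exists [ffun i => x 0 i].
    by apply/atorusP => j; rewrite ffunE.
  by congr ppoint; apply/rowP => i; rewrite !mxE big_set1 ffunE.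
exists (monomap (fun i => [set i]) t) => //; rewrite inE.
by apply/forallP => i; rewrite mxE big_set1.
Qed.

Section Fibers.

Variables (N r : nat) (E : 'I_r.+1 -> {set 'I_N}).

Lemma monomap_neq0 t i : t \in atorus N -> monomap E t 0 i != 0.
Proof. by move/atorusP => t0; rewrite mxE; apply/prodf_neq0. Qed.

Lemma monomapM (t u : {ffun 'I_N -> K}) i :
  monomap E [ffun j => t j * u j] 0 i = monomap E t 0 i * monomap E u 0 i.
Proof.
rewrite !mxE -big_split /=.
by apply: eq_bigr => j _; rewrite ffunE.
Qed.

(** The order of the kernel of the group morphism from the affine torus to the projective torus: the
    image is trivial when all coordinates agree. *)
Definition kernel_size :=
  #|[set t in atorus N | [forall i, monomap E t 0 i == monomap E t 0 0]]|.

(** Multiplication by [u] carries the kernel bijectively onto the fibre through [u]. *)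
Lemma card_fiber u : u \in atorus N ->
  #|[set t in atorus N | ppoint (monomap E t) == ppoint (monomap E u)]|
    = kernel_size.
Proof.
move=> uN; have /atorusP u0 := uN.
have inj_u : injective (fun t : {ffun 'I_N -> K} => [ffun j => t j * u j]).
  move=> t t' /ffunP tt'; apply/ffunP => j.
  by have := tt' j; rewrite !ffunE => /(mulIf (u0 j)).
rewrite /kernel_size -[RHS](card_imset _ inj_u); apply: eq_card => t; rewrite inE.
apply/andP/imsetP => [[tN]|[t' /[!inE] /andP[t'N /forallP h] ->]].
  rewrite eq_ppoint ?monomap_neq0 // => /forallP tu.
  have tK : [ffun j => [ffun j => t j / u j] j * u j] = t.
    by apply/ffunP => j; rewrite !ffunE divfK.
  exists [ffun j => t j / u j] => //; rewrite inE; apply/andP; split.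
    by apply/atorusP => j; rewrite ffunE mulf_neq0 ?invr_eq0 //; apply/atorusP.
  apply/forallP => i; have := tu i; rewrite -{1 2}tK !monomapM.
  move=> /eqP tiu; apply/eqP.
  apply: (mulIf (mulf_neq0 (monomap_neq0 i uN) (monomap_neq0 0 uN))).
  by rewrite mulrA tiu; ring.
have t'uN : [ffun j => t' j * u j] \in atorus N.
  apply/atorusP => j; rewrite ffunE mulf_neq0 //.
  by move/forallP: t'N.
split; first by rewrite inE in t'uN.
rewrite eq_ppoint ?monomap_neq0 //.
apply/forallP => i.
by rewrite !monomapM (eqP (h i)); apply/eqP; ring.
Qed.

Lemma card_preimage (W : {set {set 'rV[K]_r.+1}}) : W \subset mset E ->
  #|[set t in atorus N | ppoint (monomap E t) \in W]| = (kernel_size * #|W|)%N.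
Proof.
move=> WE; rewrite -sum1_card.
rewrite (partition_big (fun t => ppoint (monomap E t)) (mem W)) /=; last first.
  by move=> t; rewrite inE => /andP[].
rewrite mulnC -sum_nat_const; apply: eq_bigr => P PW.
have /msetP[u uN Pu] := subsetP WE _ PW.
rewrite -(card_fiber uN) -sum1_card; apply: eq_bigl => t.
by rewrite !inE -Pu andbAC; case: eqP => [->|]; rewrite ?PW ?andbT ?andbF.
Qed.

Lemma card_mset : (#|K|.-1 ^ N = kernel_size * #|mset E|)%N.
Proof.
rewrite -card_preimage // -card_atorus; apply: eq_card => t; rewrite inE.
case: (boolP (t \in _)) => //= tN; apply/esym/msetP; by exists t.
Qed.

(** Whether [f] vanishes depends only on the projective point, so the left-hand set is the full
    preimage of the support [W] of the codeword. *)
Lemma hamming_weightE d (f : dhomog r.+1 K d) :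
  #|[set t in atorus N | (val f).@[monomap E t 0] != 0]|
    = (kernel_size * hamming_weight (codeword (mset E) f))%N.
Proof.
set w := codeword _ _.
pose W := [set @enum_val _ (mem (mset E)) j | j in [set j | w 0 j != 0]].
have -> : hamming_weight w = #|W| by apply/esym/card_imset/enum_val_inj.
rewrite -card_preimage; last first.
  by apply/subsetP => P /imsetP[j _ ->]; apply: enum_valP.
apply: eq_card => t; rewrite !inE; case: (boolP [forall _, _]) => //= t0.
have tN : t \in atorus N by rewrite inE.
have PE : ppoint (monomap E t) \in mset E by apply/msetP; exists t.
have wE j : enum_val j = ppoint (monomap E t) ->
    (w 0 j != 0) = ((val f).@[monomap E t 0] != 0).
  move=> /codewordE ->; rewrite mulf_eq0 invr_eq0 (negPf (expf_neq0 _ _)) ?orbF //.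
  exact: monomap_neq0.
apply/idP/imsetP => [f0|[j /[!inE] wj /esym/wE <-] //].
exists (enum_rank_in PE (ppoint (monomap E t))); last by rewrite enum_rankK_in.
by rewrite inE wE // enum_rankK_in.
Qed.

End Fibers.

End MonomialMaps.

(** * Codes on monomial sets *)

Lemma bigminn_le (I : eqType) (s : seq I) (P : pred I) (F : I -> nat) x0 i :
  i \in s -> P i -> (\big[minn/x0]_(j <- s | P j) F j <= F i)%N.
Proof.
elim: s => [//|a s IHs]; rewrite inE big_cons => /predU1P[<-|/IHs{}IHs] Pi.
  by rewrite Pi geq_minl.
by case: ifP => _; [apply: leq_trans (geq_minr _ _) _|]; apply: IHs.
Qed.

Lemma dhomog_comp (K : comNzRingType) n p d e (f : {mpoly K[n]})
    (lq : n.-tuple {mpoly K[p]}) :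
  f \is d.-homog -> (forall i, tnth lq i \is e.-homog) ->
  f \mPo lq \is (e * d).-homog.
Proof.
move=> /dhomogP fd lqe; rewrite comp_mpolyE big_seq.
apply: rpred_sum => m /fd /= <-; apply: rpredZ; rewrite mdegE big_distrr /=.
elim/big_ind2: _ => [|x1 x2 y1 y2|i _]; [exact: dhomog1|exact: dhomogM|].
exact: dhomogMn.
Qed.

Section Codes.

Variables (K : finFieldType) (N r : nat) (E : 'I_r.+1 -> {set 'I_N}).
Let Z : {set {set 'rV[K]_r.+1}} := mset K E.

Lemma kernel_size_gt0 : (0 < kernel_size K E)%N.
Proof.
apply/card_gt0P; exists [ffun=> 1]; rewrite !inE; apply/andP; split.
  by apply/forallP => j; rewrite ffunE oner_eq0.
by apply/forallP => i; rewrite !mxE !big1 // => j _; rewrite ffunE.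
Qed.

Lemma hamming_weight_eq0 n (c : 'rV[K]_n) : (hamming_weight c == 0%N) = (c == 0).
Proof.
rewrite /hamming_weight cards_eq0; apply/eqP/eqP => [c0|->].
  apply/rowP => j; rewrite mxE; apply/eqP/negPn.
  by have := in_set0 j; rewrite -c0 inE => ->.
by apply/setP => j; rewrite !inE mxE eqxx.
Qed.

Lemma codeword_eval d (f : dhomog r.+1 K d) t j : t \in atorus K N ->
  enum_val j = ppoint (monomap E t) ->
  (codeword Z f 0 j == 0) = ((val f).@[monomap E t 0] == 0).
Proof.
move=> tN /codewordE ->; rewrite mulf_eq0 invr_eq0 (negPf (expf_neq0 _ _)) ?orbF //.
exact: monomap_neq0.
Qed.

Lemma enum_val_mset j :
  exists2 t, t \in atorus K N & @enum_val _ (mem Z) j = ppoint (monomap E t).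
Proof. exact/msetP/enum_valP. Qed.

Lemma min_distance_le d (f : dhomog r.+1 K d) : codeword Z f != 0 ->
  (min_distance Z d <= hamming_weight (codeword Z f))%N.
Proof.
move=> f0; apply: bigminn_le; first exact: mem_index_enum.
by rewrite f0 andbT; apply/mem_code; exists f.
Qed.

Lemma min_distance_attained d : exists2 f : dhomog r.+1 K d,
  codeword Z f != 0 & hamming_weight (codeword Z f) = min_distance Z d.
Proof.
rewrite /min_distance; elim/big_ind: _ => [|x y [f f0 <-] [g g0 <-]|c].
(* The default value [#|Z|] of the minimum is itself a weight, that of [X_0^d], which vanishes at no
   point of [Z]. *)
- have X0h : ('X_ord0 ^+ d : {mpoly K[r.+1]}) \is d.-homog.
    by rewrite -[X in X.-homog]mul1n; apply/dhomogMn; rewrite dhomogX /= mdeg1.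
  have w : hamming_weight (codeword Z (DHomog X0h)) = #|Z|.
    rewrite -[RHS]card_ord -cardsT; apply: eq_card => j; rewrite !inE.
    have [t tN tj] := enum_val_mset j.
    rewrite (codeword_eval _ tN tj) /= rmorphXn /= mevalXU expf_neq0 //.
    exact: monomap_neq0.
  exists (DHomog X0h) => //; rewrite -hamming_weight_eq0 w -lt0n.
  have := card_mset K E; rewrite -/Z; case: #|Z| => //; rewrite muln0 => /eqP.
  by rewrite expn_eq0 -subn1 subn_eq0 leqNgt card_finNzRing_gt1.
- by rewrite /minn; case: ifP => _; [exists f|exists g].
- by case/andP => /mem_code[f ->] f0; exists f.
Qed.

(** Conversely, a form vanishing on [Z] is its own single generator. The degree [d] part of the
    ideal is thus the kernel of the evaluation map, and the Hilbert function is its rank. *)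
Lemma vanishing_idealP d (f : dhomog r.+1 K d) :
  vanishing_ideal Z (val f) <-> codeword Z f = 0.
Proof.
split=> [[gh ghP fE]|f0].
  apply/rowP => j; rewrite [RHS]mxE; have [t tN tj] := enum_val_mset j.
  apply/eqP; rewrite (codeword_eval _ tN tj) fE rmorph_sum /= big_seq big1 //.
  move=> p /ghP[_ p0]; rewrite mevalM (p0 _ _ _ (ppoint_id _)) ?mulr0 //.
  by apply/msetP; exists t.
exists [:: (1, val f)]; last by rewrite big_seq1 mul1r.
move=> p; rewrite inE => /eqP -> /=; split; first by exists d; apply: dhomog_is_dhomog.
move=> P x PZ xP; have /msetP[t tN tP] := PZ.
have [a a0 xE] : exists2 a, a != 0 & x = a *: monomap E t.
  by apply/ppointP; rewrite -tP.
have := codeword_eval f tN (etrans (enum_rankK_in PZ PZ) tP).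
rewrite f0 mxE eqxx => /esym/eqP ft.
rewrite xE (meval_eq (v2 := fun i => a * monomap E t 0 i)); last by move=> i; rewrite mxE.
by rewrite (meval_dhomog _ _ (dhomog_is_dhomog f)) ft mulr0.
Qed.

Lemma hilbert_valueE d h : hilbert_value Z d h <-> h = \dim (code Z d).
Proof.
have rn : \dim (code Z d) =
    (\dim {: dhomog r.+1 K d} - \dim (lker (linfun (@codeword _ _ Z d))))%N.
  by rewrite -(limg_ker_dim (linfun (@codeword _ _ Z d)) fullv) capfv addKn.
split=> [[W WP ->]|->].
  rewrite rn; congr (_ - \dim _)%N; apply/vspaceP => f.
  by apply/idP/idP; rewrite memv_ker lfunE /=;
    [move/WP/vanishing_idealP->|move/eqP => f0; apply/WP/vanishing_idealP].
exists (lker (linfun (@codeword _ _ Z d))) => // f.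
rewrite memv_ker lfunE /=; split=> [/eqP/vanishing_idealP //|].
by move/vanishing_idealP/eqP.
Qed.

End Codes.

(** * Pullback of codes along maps given by forms of degree [e] *)

Section Pullback.

Variables (K : finFieldType) (N r r' : nat).
Variables (E : 'I_r.+1 -> {set 'I_N}) (E' : 'I_r'.+1 -> {set 'I_N}).
Variables (e : nat) (lq : r'.+1.-tuple {mpoly K[r.+1]}).
Hypothesis lq_homog : forall i, tnth lq i \is e.-homog.
Hypothesis lqE : forall t i,
  (tnth lq i).@[monomap E t 0] = monomap E' t 0 i.

Definition pullback d (f : dhomog r'.+1 K d) : dhomog r.+1 K (e * d) :=
  DHomog (dhomog_comp (dhomog_is_dhomog f) lq_homog).

Lemma pullback_eval d (f : dhomog r'.+1 K d) t :
  (val (pullback f)).@[monomap E t 0] = (val f).@[monomap E' t 0].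
Proof. by rewrite /= comp_mpoly_meval; apply: meval_eq => i; rewrite lqE. Qed.

(** A codeword of minimum weight for [E'] and its pullback have the same support in the affine
    torus, so their weights differ only by the ratio of the kernel sizes. *)
Lemma min_distance_pullback d :
  (kernel_size K E * min_distance (mset K E) (e * d)
     <= kernel_size K E' * min_distance (mset K E') d)%N.
Proof.
have [f f0 <-] := min_distance_attained K E' d.
have w : (kernel_size K E * hamming_weight (codeword (mset K E) (pullback f))
    = kernel_size K E' * hamming_weight (codeword (mset K E') f))%N.
  rewrite -!hamming_weightE; apply: eq_card => t.
  by rewrite !in_set pullback_eval.
rewrite -w leq_mul2l min_distance_le ?orbT // -hamming_weight_eq0.
apply: contraNneq f0 => w0; rewrite -hamming_weight_eq0.
move/esym/eqP: w; rewrite w0 muln0 muln_eq0.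
by rewrite eqn0Ngt kernel_size_gt0.
Qed.

End Pullback.

(** * Graphs *)

Section TorusAsMset.

Variable K : finFieldType.

Lemma kernel_size_torus r : kernel_size K (fun i : 'I_r.+1 => [set i]) = #|K|.-1.
Proof.
have inj_cst : injective (fun c : K => [ffun _ : 'I_r.+1 => c]).
  by move=> c d /ffunP/(_ 0); rewrite !ffunE.
have -> : #|K|.-1 = #|[set c : K | c != 0]|.
  by rewrite cardsE card_nonzero.
rewrite -(card_imset _ inj_cst); apply: eq_card => t; rewrite in_set.
apply/andP/imsetP => [[/atorusP t0 /forallP tE]|[c c0 ->]].
  exists (t 0); rewrite ?inE //; apply/ffunP => j.
  by have := tE j; rewrite !mxE !big_set1 ffunE => /eqP.
split; first by apply/atorusP => j; rewrite ffunE; rewrite inE in c0.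
by apply/forallP => i; rewrite !mxE !big_set1 !ffunE.
Qed.

Lemma card_torus r : (#|K|.-1 ^ r.+1 = #|K|.-1 * #|torus K r|)%N.
Proof. by rewrite torus_mset -(kernel_size_torus r) -card_mset kernel_size_torus. Qed.

(** Each [E i] owns a private variable [alpha i]; giving it the value [x 0 i] and all other
    variables the value 1 realizes [x]. *)
Lemma monomap_surj N r (E : 'I_r.+1 -> {set 'I_N}) (alpha : 'I_r.+1 -> 'I_N) :
  (forall i j, (alpha i \in E j) = (i == j)) ->
  forall x : 'rV[K]_r.+1, (forall i, x 0 i != 0) ->
  exists2 t, t \in atorus K N & monomap E t = x.
Proof.
move=> alphaE x x0.
exists [ffun v => \prod_i (if alpha i == v then x 0 i else 1)].
  apply/atorusP => v; rewrite ffunE; apply/prodf_neq0 => i _.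
  by case: ifP; rewrite ?oner_eq0.
apply/rowP => j; rewrite mxE; under eq_bigr do rewrite ffunE.
rewrite exchange_big (bigD1 j) //= [X in _ * X]big1 => [|i ij].
  rewrite (bigD1 (alpha j)) ?alphaE ?eqxx //= big1 ?mulr1 // => v.
  by rewrite [alpha j == v]eq_sym => /andP[_ /negPf->].
rewrite big1 // => v vE; case: eqP => // av.
by rewrite -av alphaE (negPf ij) in vE.
Qed.

Lemma mset_torus N r (E : 'I_r.+1 -> {set 'I_N}) (alpha : 'I_r.+1 -> 'I_N) :
  (forall i j, (alpha i \in E j) = (i == j)) -> mset K E = torus K r.
Proof.
move=> alphaE; apply/setP => P; apply/msetP/imsetP => [[t tN ->]|[x]].
  exists (monomap E t) => //; rewrite inE; apply/forallP => i.
  exact: monomap_neq0.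
rewrite inE => /forallP/(monomap_surj alphaE)[t tN <-] ->; by exists t.
Qed.

End TorusAsMset.

Section Graphs.

Variables (n s : nat) (G : sgraph n s.+1).

Lemma edgeP i : exists x y, [/\ x != y, G i = [set x; y] & adj G x y].
Proof.
have /eqP/cards2P[x [y [xy Gi]]] := edge_card G i.
by exists x, y; split=> //; rewrite /adj -Gi; apply: imset_f.
Qed.

Lemma adj_edge x y : adj G x y -> x != y /\ exists i, G i = [set x; y].
Proof.
move=> /imsetP[i _ Gi]; split; last by exists i.
by have := edge_card G i; rewrite -Gi cards2; case: (x != y).
Qed.

Lemma adj_connect_sym : connect_sym (adj G).
Proof. by apply: sym_connect_sym => x y; rewrite /adj setUC. Qed.

Lemma adj_root (T : Type) (phi : 'I_n -> T) :
  (forall x y, adj G x y -> phi x = phi y) ->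
  forall v, phi (fingraph.root (adj G) v) = phi v.
Proof.
move=> phiP v; have /connectP[p] := connect_root (adj G) v.
move: (fingraph.root _ v) => w; elim: p v => [v _ -> //|x p IHp v] /= /andP[vx xp] wE.
by rewrite (phiP _ _ vx); apply: IHp.
Qed.

Lemma componentsE : components G = #|roots (adj G)|.
Proof. by apply: eq_card => x; rewrite !inE andbT. Qed.

(** The blocks are disjoint pairs covering [2 * k] vertices, so there are [k] of them, and a vertex
    chosen in one block lies in no other. *)
Lemma matching_indexing k : has_perfect_matching G -> n = (2 * k)%N ->
  exists (sigma : 'I_k -> 'I_s.+1) (alpha : 'I_k -> 'I_n),
    forall i j, (alpha i \in G (sigma j)) = (i == j).
Proof.
move=> [M MG Mpart] nk.
have Mcard : #|M| = k.
  have M2 : {in M, forall B : {set 'I_n}, #|B| = 2%N}.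
    by move=> B /(subsetP MG)/imsetP[i _ ->]; apply: edge_card.
  have := card_uniform_partition M2 Mpart.
  by rewrite cardsT card_ord => nM; lia.
pose B (i : 'I_k) := @enum_val _ (mem M) (cast_ord (esym Mcard) i).
have BM i : B i \in M by apply: enum_valP.
have [sigma sigmaE] : exists sigma, forall i, B i = G (sigma i).
  apply: (@fin_all_exists _ _ (fun i e => B i = G e)) => i.
  by have /imsetP[e _ ->] := subsetP MG _ (BM i); exists e.
have [alpha alphaB] : exists alpha, forall i, alpha i \in B i.
  apply: (@fin_all_exists _ _ (fun i a => a \in B i)) => i; apply/set0Pn.
  by rewrite -card_gt0 sigmaE edge_card.
exists sigma, alpha => i j; rewrite -sigmaE.
apply/idP/eqP => [aij|<-]; last exact: alphaB.
have [_ /trivIsetP Mtriv _] := and3P Mpart.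
have /eqP : B i == B j.
  apply: contraTT aij => /(Mtriv _ _ (BM i) (BM j)) /disjoint_setI0 dij.
  by apply/negP => aij; have := in_set0 (alpha i); rewrite -dij inE alphaB aij.
by move/enum_val_inj/cast_ord_inj.
Qed.

Section Bipartite.

Variables (K : finFieldType) (A : {set 'I_n}).
Hypothesis A_bip : forall x y, adj G x y -> (x \in A) != (y \in A).

(* If every edge monomial of t takes the value c, then t is determined up to
   the sides of the bipartition: flip c t is constant on each component. *)
Let flip (c : K) (t : 'I_n -> K) v := if v \in A then t v else c / t v.

Lemma flip_adj c (t : {ffun 'I_n -> K}) : t \in atorus K n ->
  (forall i, monomap G t 0 i = c) ->
  forall x y, adj G x y -> flip c t x = flip c t y.
Proof.
move=> /atorusP t0 tc x y xy; have [xny [i Gi]] := adj_edge xy.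
have cE : c = t x * t y by rewrite -(tc i) mxE Gi big_setU1 ?big_set1 // inE.
have := A_bip xy; rewrite /flip cE.
by case: (x \in A) (y \in A) => [] [] // _; rewrite ?mulfK // mulrC mulKf.
Qed.

Lemma flipK c (t : 'I_n -> K) v : c != 0 -> flip c (flip c t) v = t v.
Proof. by rewrite /flip; case: (v \in A) => //= c0; rewrite invfM invrK mulVKf. Qed.

(** A kernel element [t] amounts to its common edge value [c] together with the value of [flip c t]
    on each component, all of them free and nonzero. *)
Lemma kernel_size_bip : kernel_size K G = (#|K|.-1 ^ (components G).+1)%N.
Proof.
have cardK : #|[set c : K | c != 0]| = #|K|.-1.
  by rewrite cardsE card_nonzero.
pose rts : {set 'I_n} := [set v in roots (adj G)].
(* Forcing the value 1 off the roots makes the function [a] unique, so that [h] is injective on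
   [D]. *)
pose D := setX [set c : K | c != 0]
  [set a : {ffun 'I_n -> K} | a \in pffun_on 1 rts [pred c : K | c != 0]].
have cardD : #|D| = (#|K|.-1 ^ (components G).+1)%N.
  rewrite cardsX cardK cardsE card_pffun_on expnS componentsE cardsE.
  by congr (_ * _ ^ _)%N; rewrite -cardK cardsE.
pose h (ca : K * {ffun 'I_n -> K}) : {ffun 'I_n -> K} :=
  [ffun v => flip ca.1 (fun v => ca.2 (fingraph.root (adj G) v)) v].
have rtsP v : fingraph.root (adj G) v \in rts.
  by rewrite in_set; apply: roots_root; apply: adj_connect_sym.
have DP c a : (c, a) \in D -> [/\ c != 0, forall v, v \in rts -> a v != 0
    & forall v, v \notin rts -> a v = 1].
  rewrite !inE /= => /andP[c0 /pfamilyP[asub aP]]; split=> // v.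
  by move=> vr; apply/eqP; apply: contraNT vr => av; apply: (subsetP asub); rewrite inE.
have hN c a : (c, a) \in D -> h (c, a) \in atorus K n.
  move=> /DP[c0 a0 _]; apply/atorusP => v; rewrite ffunE /flip /=.
  by case: ifP => _; rewrite ?mulf_neq0 ?invr_eq0 ?a0.
have hE c a i : (c, a) \in D -> monomap G (h (c, a)) 0 i = c.
  move=> /DP[c0 a0 _]; have [x [y [xny Gi xy]]] := edgeP i.
  rewrite mxE Gi big_setU1 ?inE //= big_set1 !ffunE /flip /=.
  have rE : fingraph.root (adj G) x = fingraph.root (adj G) y.
    by apply/eqP; rewrite root_connect ?connect1 //; apply: adj_connect_sym.
  have := A_bip xy; rewrite rE; have := a0 _ (rtsP y).
  by case: (x \in A) (y \in A) => [] [] // ay _; rewrite ?divfK // mulrC divfK.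
rewrite -cardD -(card_in_imset (f := h)).
  apply: eq_card => t; rewrite in_set.
  apply/andP/imsetP => [[tN /forallP tE]|[[c a] caD ->]]; last first.
    by split; [exact: hN|apply/forallP => i; rewrite !hE].
  set c := monomap G t 0 0; have c0 : c != 0 by apply: monomap_neq0.
  have phiE := adj_root (flip_adj tN (fun i => eqP (tE i))).
  exists (c, [ffun v => if v \in rts then flip c t v else 1]).
    rewrite in_setX !in_set c0; apply/pfamilyP; split.
      by apply/subsetP => v; rewrite inE ffunE; case: ifP => //; rewrite eqxx.
    move=> v vr; rewrite !inE ffunE vr /flip; move/atorusP: tN => t0.
    by case: ifP => _; rewrite ?mulf_neq0 ?invr_eq0 // t0.
  apply/ffunP => v; rewrite ffunE /= -[LHS](flipK t v c0) /flip.
  rewrite !ffunE rtsP -/(flip c t v) -/(flip c t (fingraph.root (adj G) v)) phiE.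
  by rewrite /flip; case: ifP.
move=> [c a] [c' a'] D1 D2 /ffunP hh.
have cc' : c = c'.
  by rewrite -(hE _ _ 0 D1) -(hE _ _ 0 D2); congr (monomap _ _ 0 0); apply/ffunP.
have [c0 a0 a1] := DP _ _ D1; have [_ a0' a1'] := DP _ _ D2.
congr (_, _) => //; apply/ffunP => v.
case: (boolP (v \in rts)) => vr; last by rewrite a1 ?a1'.
have rv : fingraph.root (adj G) v = v by apply/eqP; rewrite inE in vr.
have := hh v; rewrite !ffunE /flip /= rv -cc'; case: ifP => // _.
by move/(mulfI c0)/invr_inj.
Qed.

(** [F] consists of the roots and one vertex [w] on the side opposite to the root of its component.
    Comparing [flip c t] at [w] and at that root gives [c = 1]; the values 1 at the roots then
    spread to whole components. *)
Lemma rigid_vertices : exists2 F : {set 'I_n}, (#|F| <= (components G).+1)%N &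
  forall t : {ffun 'I_n -> K}, t \in atorus K n ->
    (forall i, monomap G t 0 i = monomap G t 0 0) ->
    (forall v, v \in F -> t v = 1) -> forall v, t v = 1.
Proof.
have [x [y [_ _ xy]]] := edgeP 0.
have rxy : fingraph.root (adj G) x = fingraph.root (adj G) y.
  by apply/eqP; rewrite root_connect ?connect1 //; apply: adj_connect_sym.
have [w rw wA] : exists2 w, fingraph.root (adj G) w = fingraph.root (adj G) x &
    (w \in A) != (fingraph.root (adj G) x \in A).
  case: (eqVneq (x \in A) (fingraph.root (adj G) x \in A)) => [xr|]; last by exists x.
  by exists y; rewrite // -xr eq_sym A_bip.
exists (w |: [set v in roots (adj G)]).
  by rewrite cardsU1 componentsE cardsE (leq_add2r _ _ 1%N); case: (_ \notin _).
move=> t tN tE tF; set c := monomap G t 0 0 in tE.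
have c0 : c != 0 by apply: monomap_neq0.
have phiE := adj_root (flip_adj tN tE).
have tr v : t (fingraph.root (adj G) v) = 1.
  apply: tF; rewrite in_setU1 in_set; apply/orP; right.
  by apply: roots_root; apply: adj_connect_sym.
have c1 : c = 1.
  have := phiE w; rewrite rw /flip tr (tF w) ?setU11 // divr1.
  by case: (w \in A) wA; case: (_ \in A).
move=> v; rewrite -(flipK t v c0) {1}/flip -phiE /flip tr c1 divr1.
by rewrite !if_same divr1 if_same.
Qed.

End Bipartite.

End Graphs.

(** * Characters of the affine torus *)

Section PowerSums.

Variable K : finFieldType.

(** Translation by 1 permutes [K], so adding 1 to every term does not change the sum of all
    elements. *)
Lemma card_natr0 : #|K|%:R = 0 :> K.
Proof.
apply: (addrI (\sum_(x : K) x)); rewrite addr0 -sumr_const -big_split /=.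
by rewrite [RHS](reindex_inj (addIr (1 : K))).
Qed.

Lemma expf_card_pred (x : K) : x != 0 -> x ^+ #|K|.-1 = 1.
Proof.
move=> x0; apply: (mulfI x0); rewrite -exprS mulr1 prednK ?expf_card //.
by apply: ltn_trans (card_finNzRing_gt1 K).
Qed.

(** Reindexing by [y * x] multiplies the sum by [y ^+ c], so one [y] with [y ^+ c != 1] makes it 0.
    When [q - 1] does not divide [c] such a [y] exists: otherwise [X^c' - 1], with [c'] the
    remainder of [c], would have more roots than its degree. *)
Lemma sum_expf c : \sum_(x : K | x != 0) x ^+ c = - (#|K|.-1 %| c)%N%:R.
Proof.
have q1 := card_finNzRing_gt1 K.
case: (boolP (_ %| c)%N) => [/dvdnP[e ->]|ndvd].
  rewrite (eq_bigr (fun=> 1)) => [|x x0]; last by rewrite mulnC exprM expf_card_pred ?expr1n.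
  rewrite sumr_const (eq_card (B := [pred x : K | x != 0])) // card_nonzero.
  apply: (addIr 1); rewrite addNr -[X in _ + X]/(1%:R) -natrD addn1 prednK ?card_natr0 //.
  exact: ltnW.
have [y y0 yc] : exists2 y : K, y != 0 & y ^+ c != 1.
  set c' := (c %% #|K|.-1)%N.
  have c'0 : (0 < c')%N by rewrite lt0n.
  have c'q : (c' < #|K|.-1)%N by rewrite ltn_mod -subn1 subn_gt0.
  have expc (x : K) : x != 0 -> x ^+ c = x ^+ c'.
    move=> x0; rewrite {1}(divn_eq c #|K|.-1) exprD mulnC exprM.
    by rewrite expf_card_pred // expr1n mul1r.
  case: (pickP [pred y : K | (y != 0) && (y ^+ c != 1)]) => [y /andP[]|all1]; first by exists y.
  have rts : all (root ('X^c' - 1)) (enum [pred x : K | x != 0]).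
    apply/allP => x; rewrite mem_enum inE => x0.
    have := all1 x; rewrite /= x0 /= => /negbFE/eqP xc.
    by rewrite rootE !hornerE -expc // xc subrr.
  have p0 : 'X^c' - 1 != 0 :> {poly K}.
    by rewrite -size_poly_gt0 size_XnsubC.
  have := max_poly_roots p0 rts (enum_uniq _); rewrite size_XnsubC // ltnS -cardE.
  rewrite card_nonzero.
  by rewrite leqNgt c'q.
rewrite /= oppr0; apply/eqP; rewrite -(mulrI_eq0 _ (lregP (_ : y ^+ c - 1 != 0))) ?subr_eq0 //.
rewrite mulrBl mul1r subr_eq0 mulr_sumr [eqbRHS](reindex_inj (mulfI y0)) /=.
by apply/eqP/eq_big => x; rewrite ?exprMn // mulf_eq0 negb_or y0.
Qed.

Lemma sum_atorus N (F : 'I_N -> K -> K) :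
  \sum_(t in atorus K N) \prod_j F j (t j) = \prod_j \sum_(x | x != 0) F j x.
Proof.
rewrite -[RHS]/(\prod_j \sum_(x in [pred x : K | x != 0]) F j x) bigA_distr_big.
by apply: eq_bigl => t; apply/atorusP/ffun_onP.
Qed.

(** Orthogonality of characters: multiplying by the inverse of the character [a], with exponents
    [#|K|.-1 - a j], and summing over the torus leaves [lambda a] times a power of -1. *)
Lemma characters_free N (lambda : {ffun 'I_N -> 'I_(#|K|.-1)} -> K) :
  (forall t, t \in atorus K N -> \sum_a lambda a * \prod_j t j ^+ a j = 0) ->
  forall a, lambda a = 0.
Proof.
move=> h a; have : \sum_(t in atorus K N)
    (\sum_b lambda b * \prod_j t j ^+ b j) * \prod_j t j ^+ (#|K|.-1 - a j) = 0.
  by apply: big1 => t tN; rewrite h ?mul0r.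
under eq_bigr do rewrite mulr_suml.
rewrite exchange_big (bigD1 a) //= [X in _ + X]big1 => [|b ba].
  rewrite addr0; under eq_bigr => t tN.
    rewrite -mulrA -big_split /=.
    under eq_bigr do rewrite -exprD subnKC ?(ltnW (ltn_ord _)) //.
    over.
  rewrite -mulr_sumr (sum_atorus (fun _ x => x ^+ #|K|.-1)) => /eqP.
  rewrite mulf_eq0 => /orP[/eqP //|].
  rewrite (eq_bigr (fun=> -1)) ?prodr_const => [|j _]; last by rewrite sum_expf dvdnn.
  by rewrite expf_eq0 oppr_eq0 oner_eq0 andbF.
under eq_bigr => t tN do rewrite -mulrA -big_split /=.
rewrite -mulr_sumr.
under eq_bigr => t tN do under eq_bigr do rewrite -exprD.
rewrite (sum_atorus (fun j x => x ^+ (b j + (#|K|.-1 - a j)))).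
have [j baj] : exists j, b j != a j.
  by apply/existsP; apply: contraNT ba; rewrite negb_exists => /forallP ab;
    apply/eqP/ffunP => j; apply/eqP/negPn.
rewrite (bigD1 j) //= sum_expf.
case: (boolP (_ %| _)%N) => [/dvdnP[e]|]; last by rewrite oppr0 mul0r mulr0.
move=> eE; case/eqP: baj; apply/val_inj => /=.
(* The left side lies strictly between 0 and [2 * z], which forces [e = 1]. *)
have multiple_lt2 x y z : (x + (z - y) = e * z -> x < z -> y < z -> x = y)%N.
  by case: (e) => [|[|e']]; rewrite ?mulSn; lia.
exact: multiple_lt2 eE (ltn_ord _) (ltn_ord _).
Qed.

End PowerSums.

(** * Counting bounded exponents of bounded total degree *)

Section BoundedExponents.

Variable p : nat.

Definition exponents N d : {set {ffun 'I_N -> 'I_p}} :=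
  [set a : {ffun 'I_N -> 'I_p} | (\sum_j a j <= d)%N].

Let P : {poly int} := \sum_(b < p) 'X^b.

(** [P ^+ N] is the generating polynomial of the exponent vectors by total degree. *)
Lemma card_exponents N d : #|exponents N d|%:R = \sum_(e < d.+1) (P ^+ N)`_e.
Proof.
have -> : P ^+ N = \sum_(a : {ffun 'I_N -> 'I_p}) 'X^(\sum_j a j).
  rewrite -[N in LHS]card_ord -prodr_const bigA_distr_bigA /=.
  by apply: eq_bigr => a _; rewrite -prodrXr.
under eq_bigr do rewrite coef_sum.
rewrite exchange_big -sum1_card natr_sum big_mkcond /=; apply: eq_bigr => a _.
rewrite inE; case: leqP => ad.
  rewrite (bigD1 (inord (\sum_j a j))) //= coefXn inordK // eqxx big1 ?addr0 // => e.
  by rewrite coefXn; case: (eqVneq (val e)) => // <-; rewrite inord_val eqxx.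
rewrite big1 // => e _; rewrite coefXn; case: eqP => // ea.
by have := ltn_ord e; rewrite ea ltnS leqNgt ad.
Qed.

Lemma card_exponents0 d : #|exponents 0 d| = 1%N.
Proof.
apply/eqP; rewrite -(eqr_nat int) card_exponents big_ord_recl expr0 coef1 eqxx.
by rewrite big1 ?addr0 // => i _; rewrite coef1.
Qed.

(** The recursion is the coefficient form of [P ^+ N.+1 * (1 - 'X) = P ^+ N * (1 - 'X^p)], summed up
    to degree [d]. *)
Lemma card_exponentsS N d :
  #|exponents N.+1 d|%:R =
    #|exponents N d|%:R - (p <= d)%:R * #|exponents N (d - p)|%:R
    + (0 < d)%:R * #|exponents N.+1 d.-1|%:R :> int.
Proof.
have PE : P * (1 - 'X) = 1 - 'X^p.
  by rewrite -[1 - 'X^p]opprB subrX1 /P -mulNr opprB mulrC.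
have coefE (Q : {poly int}) m e : (Q * (1 - 'X^m))`_e = Q`_e - (m <= e)%:R * Q`_(e - m).
  by rewrite mulrBr mulr1 coefB coefMXn ltnNge; case: leqP; rewrite ?mul1r ?mul0r.
have step e : (P ^+ N.+1)`_e - (0 < e)%:R * (P ^+ N.+1)`_e.-1 =
    (P ^+ N)`_e - (p <= e)%:R * (P ^+ N)`_(e - p).
  by rewrite -subn1 -!coefE exprSr -mulrA expr1 PE.
have shift (Q : {poly int}) m : \sum_(e < d.+1) (m <= e)%:R * Q`_(e - m)
    = (m <= d)%:R * \sum_(e < (d - m).+1) Q`_e.
  case: leqP => md; last first.
    by rewrite mul0r big1 // => e _; rewrite leqNgt (leq_trans (ltn_ord e) md) mul0r.
  rewrite mul1r -(big_mkord xpredT (fun e => (m <= e)%:R * Q`_(e - m))).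
  rewrite (big_cat_nat (n := m)) //=; last by apply: leqW.
  rewrite big_nat_cond big1 => [|e /andP[/andP[_ em] _]]; last by rewrite leqNgt em mul0r.
  rewrite add0r -{1}[m]add0n big_addn subSn // big_mkord; apply: eq_bigr => e _.
  by rewrite leq_addl addnK mul1r.
have : \sum_(e < d.+1) ((P ^+ N.+1)`_e - (0 < e)%:R * (P ^+ N.+1)`_e.-1) =
    \sum_(e < d.+1) ((P ^+ N)`_e - (p <= e)%:R * (P ^+ N)`_(e - p)).
  by apply: eq_bigr.
rewrite !sumrB shift -!card_exponents => <-.
have := shift (P ^+ N.+1) 1%N; under eq_bigr do rewrite subn1.
by move=> ->; rewrite subn1 -card_exponents subrK.
Qed.

(** The explicit cutoff is essential: beyond it, truncated subtraction would make the binomial 1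
    instead of 0. *)
Let tail N d j := if (j * p <= d)%N then 'C(N + (d - j * p), N)%:Z else 0.
Let term N d j : int := (-1) ^+ j * 'C(N, j)%:Z * tail N d j.

Lemma tailS N d j : tail N.+1 d j = tail N d j + (0 < d)%:R * tail N.+1 d.-1 j.
Proof.
rewrite /tail; case: d => [|d]; rewrite ?mul0r ?addr0 ?mul1r /=.
  by case: ifP => // _; rewrite !sub0n !addn0 !binn.
case: (leqP (j * p) d) => jd.
  by rewrite (leqW jd) subSn // !addSn !addnS binS PoszD addrC.
case: ifP => jd1; last by rewrite addr0.
have -> : (j * p = d.+1)%N by lia.
by rewrite subnn !addn0 !binn addr0.
Qed.

(** Pascal's rule on ['C(N.+1, j.+1)]; the part with ['C(N, j)] is the previous term with sign
    reversed and [d] lowered by [p]. *)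
Lemma term_shift N d j :
  (-1) ^+ j.+1 * 'C(N.+1, j.+1)%:Z * tail N d j.+1 =
  term N d j.+1 - (p <= d)%:R * term N (d - p) j.
Proof.
rewrite /term.
have -> : tail N d j.+1 = (p <= d)%:R * tail N (d - p) j.
  rewrite /tail mulSn; case: (leqP p d) => pd; last by rewrite mul0r; case: ifP => //; lia.
  by rewrite mul1r leq_subRL // subnDA.
by rewrite binS PoszD exprS; ring.
Qed.

Lemma sum_termS N d J : \sum_(j < J.+1) term N.+1 d j =
  \sum_(j < J.+1) term N d j - (p <= d)%:R * \sum_(j < J) term N (d - p) j
  + (0 < d)%:R * \sum_(j < J.+1) term N.+1 d.-1 j.
Proof.
have -> : \sum_(j < J.+1) term N.+1 d j =
    \sum_(j < J.+1) (-1) ^+ j * 'C(N.+1, j)%:Z * tail N d j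
    + (0 < d)%:R * \sum_(j < J.+1) term N.+1 d.-1 j.
  rewrite mulr_sumr -big_split; apply: eq_bigr => j _ /=.
  by rewrite {1}/term tailS mulrDr mulrCA.
congr (_ + _); rewrite !big_ord_recl /= -addrA; congr (_ + _).
  by rewrite /term !bin0.
rewrite mulr_sumr -sumrB; apply: eq_bigr => j _.
exact: term_shift.
Qed.

(** Both sides obey the recursion of [card_exponentsS]. The number [J] of terms is left free because
    the sum for [d - p] comes out one term shorter. *)
Lemma card_exponents_sum N d J : (0 < p)%N -> (d < J)%N ->
  #|exponents N d|%:R = \sum_(j < J) term N d j.
Proof.
move=> p0; elim: N d J => [|N IHN] d J dJ.
  case: J dJ => // J _; rewrite card_exponents0 big_ord_recl big1 => [|i _].
    by rewrite /term /tail mul0n leq0n !bin0.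
  by rewrite /term bin0n mulr0 mul0r.
case: J dJ => // J; elim: d => [|d IHd] dJ; rewrite card_exponentsS sum_termS.
  by rewrite leqNgt p0 !mul0r (IHN _ J.+1).
rewrite (IHN _ J.+1) // [d.+1.-1]/= IHd; last exact: ltnW.
case: (leqP p d.+1) => pd; last by rewrite !mul0r.
by rewrite (IHN _ J) //; lia.
Qed.

Lemma card_exponentsE N d : (0 < p)%N ->
  #|exponents N d|%:R = \sum_(0 <= j < (d %/ p).+1)
    (-1) ^+ j * 'C(N, j)%:Z * 'C(N + d - j * p, N)%:Z.
Proof.
move=> p0; rewrite (card_exponents_sum _ p0 (ltnSn d)).
rewrite -(big_mkord xpredT (term N d)).
rewrite (big_cat_nat (n := (d %/ p).+1)) //=; last by rewrite ltnS leq_div.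
have -> : \sum_((d %/ p).+1 <= j < d.+1) term N d j = 0.
  rewrite big_nat_cond big1 // => j /andP[/andP[dj _] _].
  by rewrite /term /tail leqNgt -ltn_divLR // dj mulr0.
rewrite addr0; apply: eq_big_nat => j /andP[_]; rewrite ltnS leq_divRL // => jd.
by rewrite /term /tail jd addnBA.
Qed.

End BoundedExponents.

(** * The code of a bipartite graph *)

Lemma dhomog_bigprod (K : comNzRingType) n e (I : finType) (P : pred I)
    (F : I -> {mpoly K[n]}) :
  (forall i, P i -> F i \is e.-homog) ->
  \prod_(i | P i) F i \is (#|P| * e).-homog.
Proof.
move=> Fe; rewrite -sum_nat_const.
by elim/big_ind2: _ => [|x1 x2 y1 y2|//]; [exact: dhomog1|exact: dhomogM].
Qed.

Lemma kernel_size_comp (K : finFieldType) N r r' (E : 'I_r.+1 -> {set 'I_N})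
    (sigma : 'I_r'.+1 -> 'I_r.+1) :
  (kernel_size K E <= kernel_size K (fun i => E (sigma i)))%N.
Proof.
apply/subset_leq_card/subsetP => t; rewrite !in_set => /andP[-> /forallP tE] /=.
apply/forallP => i; rewrite mxE [eqbRHS]mxE.
have := etrans (eqP (tE (sigma i))) (esym (eqP (tE (sigma 0)))).
by rewrite !mxE => ->.
Qed.

(** * Codes filling the whole space, and indicator forms *)

Section FullCodes.

Variables (K : finFieldType) (N r : nat) (E : 'I_r.+1 -> {set 'I_N}).
Let Z : {set {set 'rV[K]_r.+1}} := mset K E.

Lemma codeword0_eval d (f : dhomog r.+1 K d) t : t \in atorus K N ->
  codeword Z f = 0 -> (val f).@[monomap E t 0] = 0.
Proof.
move=> tN f0; have PZ : ppoint (monomap E t) \in Z by apply/msetP; exists t.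
apply/eqP; rewrite -(codeword_eval f tN (enum_rankK_in PZ PZ)) -/Z f0.
by rewrite mxE.
Qed.

(** The code is everything exactly when it contains a nonzero multiple of each unit vector, that is,
    when each point has an indicator form of degree [d]. *)
Lemma code_fullP d : reflect
  (forall u, u \in atorus K N -> exists f : dhomog r.+1 K d,
    forall t, t \in atorus K N -> ((val f).@[monomap E t 0] == 0) =
      (ppoint (monomap E t) != ppoint (monomap E u)))
  (\dim (code Z d) == #|Z|).
Proof.
apply: (iffP eqP) => [full u uN|full].
  have codeT : code Z d = fullv.
    by apply/eqP; rewrite eqEdim subvf dimvf dim_matrix mul1r full leqnn.
  have PZ : ppoint (monomap E u) \in Z by apply/msetP; exists u.
  have /mem_code[f fE] : delta_mx 0 (enum_rank_in PZ (ppoint (monomap E u))) \in code Z d.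
    by rewrite codeT memvf.
  exists f => t tN; have QZ : ppoint (monomap E t) \in Z by apply/msetP; exists t.
  rewrite -(codeword_eval f tN (enum_rankK_in PZ QZ)) -/Z -fE mxE eqxx /=.
  rewrite (can_in_eq (enum_rankK_in PZ)) //.
  by case: (ppoint (monomap E t) == _); rewrite ?oner_eq0 ?eqxx.
suff -> : code Z d = fullv by rewrite dimvf dim_matrix mul1r.
apply/eqP; rewrite eqEsubv subvf; apply/subvP => v _.
rewrite (row_sum_delta v); apply: memv_suml => j _; apply: memvZ.
have [u uN uj] := enum_val_mset j; have [f fE] := full u uN.
have -> : delta_mx 0 j = (codeword Z f 0 j)^-1 *: codeword Z f.
  apply/rowP => l; have [t tN tl] := enum_val_mset l.
  rewrite [LHS]mxE [RHS]mxE eqxx /=.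
  have := codeword_eval f tN tl; rewrite fE // -tl -uj (inj_eq enum_val_inj).
  case: (eqVneq l j) => [->|_ /eqP ->]; last by rewrite mulr0.
  by move/negbT => fj; rewrite mulVf.
by apply: memvZ; apply/mem_code; exists f.
Qed.

End FullCodes.

(** * Consequences of projecting to a perfect matching with [k.+1] edges *)

Section ToricCode.

Variables (K : finFieldType) (n s k : nat) (G : sgraph n s.+1).
Variable A : {set 'I_n}.
Hypothesis A_bip : forall x y, adj G x y -> (x \in A) != (y \in A).
Hypothesis nk : n = (2 * k.+1)%N.
Variables (sigma : 'I_k.+1 -> 'I_s.+1) (alpha : 'I_k.+1 -> 'I_n).
Hypothesis alphaE : forall i j, (alpha i \in G (sigma j)) = (i == j).

Let q1 := #|K|.-1.
Let m := components G.
Let Z : {set {set 'rV[K]_s.+1}} := mset K G.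
Let M i := G (sigma i).

Let q1_gt0 : (0 < q1)%N.
Proof. by rewrite /q1 -subn1 subn_gt0 card_finNzRing_gt1. Qed.

Lemma monomap_sigma t i : monomap M t 0 i = monomap G t 0 (sigma i) :> K.
Proof. by rewrite !mxE. Qed.

(** The matching monomials map the affine torus of dimension [2 * k.+1] onto a projective torus with
    [q1 ^ k] points. *)
Lemma kernel_size_matching : kernel_size K M = (q1 ^ k.+2)%N.
Proof.
have := card_mset K M; rewrite (mset_torus K alphaE) => h1.
have h2 := card_torus K k.
have T : #|torus K k| = (q1 ^ k)%N.
  by apply/eqP; rewrite -(eqn_pmul2l q1_gt0) -expnS h2.
apply/eqP; rewrite -(@eqn_pmul2r (q1 ^ k)) ?expn_gt0 ?q1_gt0 // -T -h1 T -expnD.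
by rewrite nk; apply/eqP; congr (_ ^ _)%N; lia.
Qed.

(** Dropping coordinates can only enlarge the kernel, whence [q1 ^ m.+1 <= q1 ^ k.+2]; the exponents
    can be compared once the base exceeds 1. *)
Lemma components_le : (1 < q1)%N -> (m <= k.+1)%N.
Proof.
move=> q1_gt1; have := kernel_size_comp K G sigma.
by rewrite kernel_size_matching (kernel_size_bip K A_bip) leq_exp2l.
Qed.

Lemma kernel_size_ratio : (kernel_size K M = kernel_size K G * q1 ^ (k.+1 - m))%N.
Proof.
rewrite kernel_size_matching (kernel_size_bip K A_bip) -/q1 -/m -expnD.
(* Over the field with two elements [q1 = 1] and every power is 1, whatever the truncated
   exponent. *)
case: (ltngtP 1 q1) => [/components_le mk|q1_lt1|<-]; last by rewrite !exp1n.
  by congr (_ ^ _)%N; lia.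
by move: q1_gt0; rewrite lt0n -leqn0 -ltnS q1_lt1.
Qed.

Lemma card_toric : #|Z| = (q1 ^ (n - m - 1))%N.
Proof.
have := card_mset K G; rewrite (kernel_size_bip K A_bip) -/q1 -/m -/Z => h.
apply/eqP; rewrite -(@eqn_pmul2l (q1 ^ m.+1)) ?expn_gt0 ?q1_gt0 // -h -expnD.
case: (ltngtP 1 q1) => [/components_le mk|q1_lt1|<-]; last by rewrite !exp1n.
  by apply/eqP; congr (_ ^ _)%N; lia.
by move: q1_gt0; rewrite lt0n -leqn0 -ltnS q1_lt1.
Qed.

Lemma min_distance_upper d :
  (min_distance Z d <= q1 ^ (k.+1 - m) * min_distance (torus K k) d)%N.
Proof.
have lqh i : tnth [tuple 'X_(sigma i) : {mpoly K[s.+1]} | i < k.+1] i \is 1.-homog.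
  by rewrite tnth_mktuple dhomogX /= mdeg1.
have lqE (t : {ffun 'I_n -> K}) i :
    (tnth [tuple 'X_(sigma i) : {mpoly K[s.+1]} | i < k.+1] i).@[monomap G t 0]
      = monomap M t 0 i.
  by rewrite tnth_mktuple mevalXU monomap_sigma.
have := min_distance_pullback lqh lqE d.
rewrite kernel_size_ratio mul1n -mulnA leq_pmul2l ?kernel_size_gt0 //.
by rewrite (mset_torus K alphaE).
Qed.

Definition edge_monomials : s.+1.-tuple {mpoly K[n]} :=
  [tuple \prod_(j in G i) 'X_j | i < s.+1].

Lemma edge_monomials_homog i : tnth edge_monomials i \is 2.-homog.
Proof.
rewrite tnth_mktuple -[2%N](edge_card G i) -[#|_|]muln1.
by apply: dhomog_bigprod => j _; rewrite dhomogX /= mdeg1.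
Qed.

Lemma edge_monomials_eval (t : 'I_n -> K) i :
  (tnth edge_monomials i).@[t] = \prod_(j in G i) t j.
Proof.
rewrite tnth_mktuple rmorph_prod; apply: eq_bigr => j _.
by rewrite /= mevalXU.
Qed.

Lemma dim_code_lower d : (#|exponents q1 k d| <= \dim (code Z d))%N.
Proof.
(* The monomial with exponents [a] in the last [k] matching variables, homogenized to degree [d] by
   the first one. *)
pose mon (a : {ffun 'I_k -> 'I_q1}) : {mpoly K[s.+1]} :=
  'X_(sigma 0) ^+ (d - \sum_i a i) * \prod_i 'X_(sigma (lift 0 i)) ^+ a i.
have Xh i e : 'X_i ^+ e \is [in K[s.+1], e.-homog].
  by rewrite -[X in X.-homog]mul1n; apply: dhomogMn; rewrite dhomogX /= mdeg1.
have monh (i : 'I_#|exponents q1 k d|) : mon (enum_val i) \is d.-homog.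
  have := enum_valP i; rewrite inE => ad.
  rewrite -[X in X.-homog](subnK ad); apply: dhomogM => //.
  by elim/big_ind2: _ => [|x1 x2 y1 y2|//]; [exact: dhomog1|exact: dhomogM].
pose X := [tuple codeword Z (DHomog (monh i)) | i < #|exponents q1 k d|].
have Xcode : {subset X <= code Z d}.
  by move=> c /mapP[i _ ->]; apply/mem_code; exists (DHomog (monh i)).
have: free X.
  apply/freeP => c; under eq_bigr do rewrite -tnth_nth tnth_mktuple -linearZ.
  rewrite -linear_sum; set f := \sum_i _ => f0.
  (* Extends [c] by zero to all exponent functions, as [characters_free] requires. *)
  pose lambda a := \sum_(i | enum_val i == a) c i.
  have lambdaE i : lambda (enum_val i) = c i.
    by rewrite /lambda (bigD1 i) //= big1 ?addr0 // => j /andP[/eqP/enum_val_inj->]; rewrite eqxx.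
  suff lambda0 a : lambda a = 0 by move=> i; rewrite -lambdaE lambda0.
  apply: characters_free a => t /atorusP t0.
  (* Dehomogenization: the coordinate at [sigma 0] is 1 and the others are those of [t]. *)
  pose x : 'rV[K]_k.+1 := \row_i oapp t 1 (unlift 0 i).
  have x0 i : x 0 i != 0 by rewrite mxE; case: unliftP => [j|] _ /=; rewrite ?oner_eq0.
  have [u uN ux] := monomap_surj alphaE x0.
  have monE a : (mon a).@[monomap G u 0] = \prod_j t j ^+ a j.
    rewrite mevalM rmorphXn /= mevalXU -monomap_sigma ux mxE unlift_none expr1n mul1r.
    rewrite rmorph_prod; apply: eq_bigr => j _.
    by rewrite rmorphXn /= mevalXU -monomap_sigma ux mxE liftK.
  have := codeword0_eval uN f0; rewrite /f linear_sum rmorph_sum /= => fE.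
  rewrite -[RHS]fE; rewrite (eq_bigr (fun i => c i * \prod_j t j ^+ (enum_val i : {ffun _}) j)).
    rewrite (partition_big enum_val predT) //=; apply: eq_bigr => a _.
    by rewrite mulr_suml; apply: eq_bigr => i /eqP ->.
  by move=> i _; rewrite mevalZ monE.
rewrite /free size_tuple => /eqP <-; apply/dimvS/span_subvP => c; exact: Xcode.
Qed.

(** An indicator of [P] is a product of linear forms: the [lin i c] kill the points whose matching
    coordinates differ from those of [P], and the [ell Q] kill the rest of its fibre. *)
Lemma regularity_upper :
  \dim (code Z (q1.-1 * k + q1 ^ (k.+1 - m) - 1)) == #|Z|.
Proof.
set D := (_ - 1)%N; apply/code_fullP => u uN; set y := monomap G u.
have y0 i : y 0 i != 0 by apply: monomap_neq0.
(* The fibre of [P] under projection to the matching coordinates. *)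
pose W := [set Q in Z | [forall i, prepr Q 0 (sigma i) * y 0 (sigma 0) ==
                             y 0 (sigma i) * prepr Q 0 (sigma 0)]].
have WP t : t \in atorus K n -> (ppoint (monomap G t) \in W) =
    (ppoint (monomap M t) == ppoint (monomap M u)).
  move=> tN; rewrite in_set.
  have -> /= : ppoint (monomap G t) \in Z by apply/msetP; exists t.
  rewrite eq_ppoint ?monomap_neq0 //; have [a a0 ->] := prepr_ppoint (monomap G t).
  have aE i : (a *: monomap G t) 0 i = a * monomap G t 0 i by rewrite mxE.
  apply: eq_forallb => i; rewrite !monomap_sigma !aE -mulrA [X in _ == X]mulrCA.
  by rewrite (inj_eq (mulfI a0)).
have WZ : W \subset Z by apply/subsetP => Q; rewrite inE => /andP[].
have cardW : #|W| = (q1 ^ (k.+1 - m))%N.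
  apply/eqP; rewrite -(eqn_pmul2l (kernel_size_gt0 K G)) -kernel_size_ratio.
  rewrite -(card_preimage WZ) -(card_fiber M uN); apply/eqP/eq_card => t.
  by rewrite in_set [RHS]in_set; case: (boolP (t \in atorus K n)) => //= /WP ->.
set P := ppoint y; have PW : P \in W by rewrite WP.
(* A coordinate telling [Q] from [P]. [ell Q] vanishes at [Q] whatever the index; the default 0 is
   never reached for [Q] in [Z] other than [P]. *)
pose idx Q := odflt 0 [pick i | prepr Q 0 i * y 0 0 != y 0 i * prepr Q 0 0].
pose ell Q : {mpoly K[s.+1]} := prepr Q 0 0 *: 'X_(idx Q) - prepr Q 0 (idx Q) *: 'X_0.
pose lin (i : 'I_k) c : {mpoly K[s.+1]} := 'X_(sigma (lift 0 i)) - c *: 'X_(sigma 0).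
pose bad (i : 'I_k) := [pred c | (c != 0) && (c != y 0 (sigma (lift 0 i)) / y 0 (sigma 0))].
pose f := (\prod_i \prod_(c | bad i c) lin i c) * \prod_(Q in W :\ P) ell Q.
have X1 i : 'X_i \is [in K[s.+1], 1.-homog] by rewrite dhomogX /= mdeg1.
have fh : f \is D.-homog.
  (* The final -1 in [D] accounts for [P], which gets no factor [ell]. *)
  have -> : D = (#|'I_k| * (q1.-1 * 1) + #|W :\ P| * 1)%N.
    rewrite /D (cardsD1 P W) PW add1n in cardW *.
    by rewrite -cardW addnS subn1 /= card_ord !muln1 mulnC.
  apply: dhomogM; apply: dhomog_bigprod => i _; last by rewrite rpredB ?rpredZ.
  have <- : #|bad i| = q1.-1.
    rewrite /q1 -card_nonzero [in RHS](cardD1 (y 0 (sigma (lift 0 i)) / y 0 (sigma 0))).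
    rewrite inE mulf_neq0 ?invr_eq0 ?y0 //=.
    by apply: eq_card => c; rewrite !inE andbC.
  by apply: dhomog_bigprod => c _; rewrite rpredB ?rpredZ.
exists (DHomog fh) => t tN /=; set x := monomap G t.
have x0 i : x 0 i != 0 by apply: monomap_neq0.
have linE i c (z : 'rV[K]_s.+1) : (lin i c).@[z 0] = z 0 (sigma (lift 0 i)) - c * z 0 (sigma 0).
  by rewrite mevalB mevalZ !mevalXU.
have ellE Q (z : 'rV[K]_s.+1) :
    (ell Q).@[z 0] = prepr Q 0 0 * z 0 (idx Q) - prepr Q 0 (idx Q) * z 0 0.
  by rewrite mevalB !mevalZ !mevalXU.
rewrite mevalM !rmorph_prod /= -/P; case: (eqVneq (ppoint x) P) => [xP|xP] /=.
  have [b b0 xE] : exists2 b, b != 0 & x = b *: y.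
    by apply/ppointP; rewrite -/P -xP ppoint_id.
  have xbE i : x 0 i = b * y 0 i by rewrite xE mxE.
  apply/negbTE; rewrite mulf_neq0 //; [apply/prodf_neq0 => i _|apply/prodf_neq0 => Q].
    rewrite rmorph_prod; apply/prodf_neq0 => c /andP[_ cy] /=; rewrite linE subr_eq0.
    apply: contraNneq cy; rewrite !xbE mulrCA => /(mulfI b0) ->.
    by rewrite mulfK.
  rewrite !inE => /and3P[QP QZ _]; rewrite ellE subr_eq0.
  have /msetP[v vN QE] := QZ; have [a a0 Qa] := prepr_ppoint (monomap G v).
  have : [exists i, prepr Q 0 i * y 0 0 != y 0 i * prepr Q 0 0].
    apply: contraNT QP => /existsPn h; rewrite QE -(ppointZ _ a0) -Qa -QE eq_ppoint //.
      by apply/forallP => i; apply/negPn.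
    by rewrite QE Qa mxE mulf_neq0 ?monomap_neq0.
  rewrite /idx; case: pickP => [i /= iP _|h /existsP[i]]; last by rewrite h.
  apply: contraNneq iP; rewrite !xbE => e.
  by apply/eqP/(mulfI b0); rewrite mulrCA -e; ring.
apply/eqP; case: (boolP (ppoint x \in W)) => xW.
  rewrite [X in _ * X](bigD1 (ppoint x)) ?in_setD1 ?xP //= ellE.
  have [a a0 ->] := prepr_ppoint x.
  by rewrite !mxE; ring.
(* Outside the fibre some ratio to the coordinate [sigma 0] differs from that of [y], so it is a
   [bad] value and its linear factor vanishes. *)
have [i] : exists i, x 0 (sigma i) * y 0 (sigma 0) != y 0 (sigma i) * x 0 (sigma 0).
  apply/existsP; move: xW; rewrite WP // eq_ppoint ?monomap_neq0 // negb_forall.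
  by under eq_existsb do rewrite !monomap_sigma.
case: (unliftP 0 i) => [j ->|->]; last by rewrite mulrC eqxx.
move=> xy; rewrite (bigD1 j) //= rmorph_prod (bigD1 (x 0 (sigma (lift 0 j)) / x 0 (sigma 0))).
  by rewrite /= linE divfK // subrr !mul0r.
rewrite /= mulf_neq0 ?invr_eq0 //=; apply: contraNneq xy => /(canRL (divfK (x0 _))) ->.
by rewrite mulrAC divfK.
Qed.

End ToricCode.

(* Summing against the coordinates outside F, with those in F frozen to 1,
   annihilates every monomial of p unless its exponents outside F are all
   congruent to -1 modulo q - 1. *)
Lemma dhomog_support_degree (K : finFieldType) n d (F : {set 'I_n})
    (p : {mpoly K[n]}) (one := [ffun=> 1] : {ffun 'I_n -> K}) :
  p \is d.-homog -> p.@[one] != 0 ->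
  (forall t, t \in atorus K n -> p.@[t] != 0 ->
     (forall v, v \in F -> t v = 1) -> forall v, t v = 1) ->
  (#|K|.-2 * (n - #|F|) <= d)%N.
Proof.
move=> /dhomogP pd p1 pF.
pose psi v x : K := if v \in F then (x == 1)%:R else x.
have onet : one \in atorus K n by apply/atorusP => v; rewrite ffunE oner_eq0.
(* The factors [psi] kill every [t] not equal to 1 on [F], and among the others only [one] supports
   [p]. *)
have sumE : \sum_(t in atorus K n) p.@[t] * \prod_v psi v (t v) = p.@[one].
  rewrite (bigD1 one) //= [X in _ + X]big1 => [|t /andP[tN t1]].
    rewrite addr0 [X in _ * X]big1 ?mulr1 // => v _.
    by rewrite /psi ffunE eqxx; case: ifP.
  apply/eqP; apply: contraNT t1; rewrite mulf_eq0 negb_or => /andP[pt /prodf_neq0 psit].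
  apply/eqP/ffunP => v; rewrite ffunE; apply: (pF _ tN pt) => w wF.
  have := psit w isT; rewrite /psi wF; case: (eqVneq (t w) 1) => //.
  by rewrite eqxx.
have sum0 : \sum_(mu <- msupp p) p@_mu * \prod_v \sum_(x | x != 0) x ^+ mu v * psi v x != 0.
  suff -> : \sum_(mu <- msupp p) p@_mu * \prod_v \sum_(x | x != 0) x ^+ mu v * psi v x
      = p.@[one] by [].
  rewrite -sumE; under [RHS]eq_bigr do rewrite mevalE mulr_suml.
  rewrite exchange_big; apply: eq_bigr => mu _ /=.
  rewrite -(sum_atorus (fun v x => x ^+ mu v * psi v x)) mulr_sumr.
  by apply: eq_bigr => t _; rewrite -mulrA -big_split.
have [mu mup muF] : exists2 mu, mu \in msupp p &
    forall v, v \notin F -> (#|K|.-1 %| (mu v).+1)%N.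
  have : has (fun mu : 'X_{1..n} => [forall (v | v \notin F), #|K|.-1 %| (mu v).+1]%N) (msupp p).
    apply: contraNT sum0 => /hasPn h; rewrite big_seq big1 // => mu /h.
    rewrite negb_forall_in => /exists_inP[v vF vmu]; rewrite (bigD1 v) //=.
    under eq_bigr do rewrite /psi (negPf vF) -exprSr.
    by rewrite sum_expf (negPf vmu) oppr0 mul0r mulr0.
  by case/hasP => mu mup /forall_inP; exists mu.
(* Off [F], divisibility of the positive number [(mu v).+1] by [q - 1] gives [mu v] at least
   [q - 2]. *)
rewrite -(pd _ mup) /= mdegE (bigID (mem F)) /=; apply: leq_trans (leq_addl _ _).
have -> : (n - #|F|)%N = #|~: F| by rewrite [RHS]cardsCs setCK card_ord.
rewrite mulnC -sum_nat_const; under eq_bigl do rewrite inE.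
apply: leq_sum => v /muF/(dvdn_leq (ltn0Sn _)) le_mu.
by rewrite -subn1 leq_subLR add1n.
Qed.

(** Pullback by the edge monomials, of degree 2; the factor is the ratio of the kernel sizes
    [q1 ^ m.+1] and [q1]. *)
Lemma min_distance_lower (K : finFieldType) n s (G : sgraph n.+1 s.+1)
    (A : {set 'I_n.+1}) d :
  (forall x y, adj G x y -> (x \in A) != (y \in A)) ->
  (min_distance (torus K n) (2 * d)
     <= #|K|.-1 ^ components G * min_distance (mset K G) d)%N.
Proof.
move=> A_bip; have lqE (t : {ffun 'I_n.+1 -> K}) i :
    (tnth (edge_monomials K G) i).@[monomap (fun j => [set j]) t 0] = monomap G t 0 i.
  rewrite edge_monomials_eval mxE; apply: eq_bigr => j _.
  by rewrite mxE big_set1.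
have := min_distance_pullback (edge_monomials_homog K G) lqE d.
rewrite kernel_size_torus (kernel_size_bip K A_bip) expnS -mulnA leq_pmul2l ?torus_mset //.
by rewrite -subn1 subn_gt0 card_finNzRing_gt1.
Qed.

(** * Lower bound for the regularity index *)

Section RegularityLowerBound.

Variables (K : finFieldType) (n s : nat) (G : sgraph n s.+1) (A : {set 'I_n}).
Hypothesis A_bip : forall x y, adj G x y -> (x \in A) != (y \in A).

(** The pulled-back indicator of [[1:...:1]] is supported on the kernel, where fixing the vertices
    of [rigid_vertices] to 1 leaves only the all-ones point. *)
Lemma regularity_lower d : \dim (code (mset K G) d) = #|mset K G| ->
  (#|K|.-2 * (n - (components G).+1) <= 2 * d)%N.
Proof.
move=> /eqP/code_fullP full.
pose one : {ffun 'I_n -> K} := [ffun=> 1].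
have oneN : one \in atorus K n by apply/atorusP => v; rewrite ffunE oner_eq0.
have one1 i : monomap G one 0 i = 1 by rewrite mxE big1 // => v _; rewrite ffunE.
have [f fE] := full _ oneN.
have pE (t : {ffun 'I_n -> K}) : (val f \mPo edge_monomials K G).@[t] =
    (val f).@[monomap G t 0].
  by rewrite comp_mpoly_meval; apply: meval_eq => i; rewrite edge_monomials_eval mxE.
have [F Fcard FP] := rigid_vertices K A_bip.
apply: leq_trans (dhomog_support_degree (F := F)
  (dhomog_comp (dhomog_is_dhomog f) (edge_monomials_homog K G)) _ _).
- by rewrite leq_mul2l leq_sub2l ?orbT.
- by rewrite pE fE // eqxx.
move=> t tN; rewrite pE fE // negbK eq_ppoint ?monomap_neq0 // => /forallP tE.
by apply: FP => // i; have := eqP (tE i); rewrite !one1 mulr1 mul1r.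
Qed.

End RegularityLowerBound.

(** The guard on the lower bound for the regularity index excludes [k = 1] with [q > 2]: there the
    graph is one edge, the toric set is one point with regularity index 0, and the bound would be
    1. *)
Theorem theorem3p1 (K : finFieldType) (q n k m s : nat) (G : sgraph n s.+1)
    (hq : q = #|K|) (hn : n = (2 * k)%N) (hm : m = components G)
    (hbip : bipartite G) (hpm : has_perfect_matching G) :
  [/\ #|toric_set K G| = ((q - 1) ^ (n - m - 1))%N,
      exists reg : nat,
        [/\ regularity_index (toric_set K G) reg,
            (1 < k)%N || (q == 2)%N ->
              Num.ceil (((q - 2) * (n - 1))%:R / (2 * (q - 1) ^ m)%:R : rat)
                <= reg%:Z
          & (reg <= (q - 2) * (k - 1) + (q - 1) ^ (k - m) - 1)%N],
      forall d : nat,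
        \sum_(0 <= j < (d %/ (q - 1)).+1)
          (-1) ^+ j * 'C(k - 1, j)%:Z * 'C(k - 1 + d - j * (q - 1), k - 1)%:Z
        <= (\dim (code (toric_set K G) d))%:Z
    & forall d : nat,
        Num.ceil ((min_distance (torus K n.-1) (2 * d))%:R
                    / ((q - 1) ^ m)%:R : rat)
          <= (min_distance (toric_set K G) d)%:Z /\
        (min_distance (toric_set K G) d
          <= (q - 1) ^ (k - m) * min_distance (torus K k.-1) d)%N].
Proof.
(* The graph has at least one edge, hence a vertex; this also makes [k] positive below. *)
case: n G hn hm hbip hpm => [|n] G hn hm [A A_bip] hpm.
  by have [[x ltx0] _] := edgeP G 0; exfalso; rewrite ltn0 in ltx0.
have q_gt1 : (1 < q)%N by rewrite hq card_finNzRing_gt1.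
have q1E : (q - 1)%N = #|K|.-1 by rewrite hq subn1.
have q2E : (q - 2)%N = #|K|.-2 by rewrite hq subn2.
case: k hn => [//|k hn].
have [sigma [alpha alphaE]] := matching_indexing hpm hn.
have q1_gt0 : (0 < q - 1)%N by rewrite subn_gt0.
have ZE : toric_set K G = mset K G by [].
have reg_ex : exists e, \dim (code (mset K G) e) == #|mset K G|.
  by eexists; apply: (regularity_upper K A_bip hn alphaE).
rewrite ZE [(k.+1 - 1)%N]subn1 /=; split.
- by rewrite hm q1E (card_toric K A_bip hn alphaE).
- case: (ex_minnP reg_ex) => e /eqP e_full e_min; exists e; split.
  + split=> [|d]; first by apply/hilbert_valueE.
    by move/hilbert_valueE => d_full; apply: e_min; rewrite -d_full.
  + have := regularity_lower A_bip e_full; rewrite -q2E -hm => low k1.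
    rewrite ceil_le_int ler_pdivrMr ?ltr0n ?muln_gt0 ?expn_gt0 ?q1_gt0 //.
    rewrite -[e%:~R]/(e%:R) -natrM ler_nat.
    case/orP: k1 => [k1|/eqP ->]; last by rewrite subnn mul0n.
    case: (ltngtP q 2) => [|q3|->]; [by rewrite ltnNge q_gt1| |by rewrite subnn mul0n].
    have mk : (m <= k.+1)%N.
      by rewrite hm; apply: (components_le (K := K) A_bip hn alphaE); rewrite -q1E ltn_subRL.
    have pow : (m < (q - 1) ^ m)%N by apply: ltn_expl; rewrite ltn_subRL.
    have -> : (e * (2 * (q - 1) ^ m) = (2 * e) * (q - 1) ^ m)%N by rewrite mulnCA mulnA.
    (* With [n.+1] vertices it remains to see [n <= (n - m) * (q - 1) ^ m]. Since [m < (q - 1) ^ m],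
       it suffices that [n <= (n - m) * m.+1], which follows from [m < n]; this is where a matching
       with at least two edges is used. *)
    apply: leq_trans (leq_mul low (leqnn _)); rewrite -mulnA leq_mul2l; apply/orP; right.
    apply: leq_trans (leq_mul (leqnn _) pow); nia.
  + apply: e_min; rewrite q1E q2E hm.
    exact: (regularity_upper K A_bip hn alphaE).
- move=> d; rewrite q1E -card_exponentsE; last by rewrite -q1E.
  rewrite natz lez_nat; exact: (dim_code_lower K alphaE).
- move=> d; split; last first.
    by rewrite q1E hm; apply: (min_distance_upper K A_bip hn alphaE).
  rewrite ceil_le_int ler_pdivrMr ?ltr0n ?expn_gt0 ?q1_gt0 //.
  rewrite -[X in X * _]/(_%:R) -natrM ler_nat.
  by rewrite [leqRHS]mulnC q1E hm; apply: min_distance_lower A_bip.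
Qed.
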